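(* Let $B$ be an affine $\mathbb{C}$-domain and let $D$ be a locally finite derivation of $B$ with Jordan decomposition $D=D_s+D_n$. Assume that there exists a subset $\Omega\subset\mathbb{C}$ such that: (1) for every $b\in B$, all eigenvalues of the restriction $D_s|_{V_b}$ of the semisimple part belong to $\Omega$, where $V_b=\operatorname{span}_{\mathbb{C}}\{D^n(b)\mid n\ge 0\}$; (2) the map $\exp\colon\Omega\to\mathbb{C}^*$, $\omega\mapsto e^{\omega}$, is injective. Then $\operatorname{Aut}_D(B)=\operatorname{Aut}_{\exp(D)}(B)$.
   Context: An affine $\mathbb{C}$-domain is a finitely generated commutative $\mathbb{C}$-algebra that is an integral domain; $\operatorname{Aut}(B)$ is the group of $\mathbb{C}$-algebra automorphisms of $B$. A derivation $D$ of $B$ ($\mathbb{C}$-linear, satisfying the Leibniz rule) is locally finite if for every $b\in B$ the space $V_b=\operatorname{span}_{\mathbb{C}}\{D^n(b)\mid n\ge 0\}$ is finite-dimensional; semisimple if $B$ has a $\mathbb{C}$-basis of eigenvectors of $D$; locally nilpotent if for every $b\in B$ some power $D^j$ kills $b$. Every locally finite derivation has a unique Jordan decomposition $D=D_s+D_n$ into a semisimple derivation $D_s$ and a locally nilpotent derivation $D_n$ of $B$ with $[D_s,D_n]=0$; the subspaces $V_b$ are stable under $D_s$ and $D_n$. The exponential $\exp(D)$ is the $\mathbb{C}$-algebra automorphism of $B$ given by $\exp(D)(b)=\exp(D|_{V_b})(b)$, where $\exp(D|_{V_b})=\sum_{n\ge 0}\frac{1}{n!}(D|_{V_b})^n$ is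 the usual exponential of a linear operator on the finite-dimensional complex vector space $V_b$. The isotropy groups are $\operatorname{Aut}_D(B)=\{\varphi\in\operatorname{Aut}(B)\mid \varphi D\varphi^{-1}=D\}$ and $\operatorname{Aut}_{\exp(D)}(B)=\{\varphi\in\operatorname{Aut}(B)\mid \varphi\exp(D)\varphi^{-1}=\exp(D)\}$. *)

(* Defs.v *)
From HB Require Import structures.
From mathcomp Require Import all_boot all_order all_algebra.
From mathcomp Require Import all_classical all_reals all_analysis.
From mathcomp Require Import complex.
(* [mpoly] is not imported: its notations clash with those of analysis. *)
From mathcomp Require mpoly.

Set Implicit Arguments.
Unset Strict Implicit.
Unset Printing Implicit Defensive.

Import Order.TTheory GRing.Theory Num.Theory numFieldNormedType.Exports.

Local Open Scope classical_set_scope.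
Local Open Scope ring_scope.
Local Open Scope complex_scope.

Section LinearAlgebra.
Context {K : fieldType} {V : lmodType K}.
Implicit Types (W : set V) (T : V -> V).

Definition linspan W : set V :=
  [set v | exists n (s : 'I_n -> V) (c : 'I_n -> K),
     (forall i, W (s i)) /\ v = \sum_i c i *: s i].

Definition free_family (I : Type) (e : I -> V) : Prop :=
  forall n (f : 'I_n -> I), injective f ->
  forall c : 'I_n -> K,
    \sum_i c i *: e (f i) = 0 -> forall i, c i = 0.

Definition is_basis (I : Type) (e : I -> V) W : Prop :=
  free_family e /\ linspan (range e) = W.

Definition finite_dimensional W : Prop :=
  exists n (e : 'I_n -> V), is_basis e W.

Definition eigenvalue_on T W (a : K) : Prop :=
  exists v, [/\ W v, v != 0 & T v = a *: v].

Definition cyclic_space T (b : V) : set V :=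
  linspan (range (fun n => iter n T b)).

Definition locally_finite T : Prop :=
  forall b, finite_dimensional (cyclic_space T b).

Definition semisimple T : Prop :=
  exists (I : Type) (e : I -> V),
    is_basis e setT /\ forall i, exists a : K, T (e i) = a *: e i.

Definition locally_nilpotent T : Prop :=
  forall b, exists n, iter n T b = 0.

End LinearAlgebra.

Section Exponential.
Context {R : realType}.

(* The regular module R[i]^o carries the usual topology of the complex numbers,
   and 'M[R[i]^o]_n the product topology. *)
Definition expC (z : R[i]) : R[i] :=
  limn (series (fun k => z ^+ k / k`!%:R : R[i]^o)).

Definition expmx n (A : 'M[R[i]]_n) : 'M[R[i]]_n :=
  limn (series (fun k => k`!%:R^-1 *: A ^+ k : 'M[R[i]^o]_n)).

(* exp(T|_W)(v), for W finite-dimensional and T-stable and v in W: it is read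
   off in coordinates, A being the matrix (acting on row vectors) of T|_W in a
   basis e of W. The value does not depend on e; it is 0 if no such e exists. *)
Definition exp_on (V : lmodType R[i]) (T : V -> V) (W : set V) (v : V) : V :=
  xget 0 [set w | exists n (e : 'I_n -> V) (A : 'M[R[i]]_n) (c : 'rV[R[i]]_n),
    [/\ is_basis e W,
        forall i, T (e i) = \sum_j A i j *: e j,
        v = \sum_i c 0 i *: e i &
        w = \sum_j (c *m expmx A) 0 j *: e j]].

Definition exp_lf (V : lmodType R[i]) (T : V -> V) (b : V) : V :=
  exp_on T (cyclic_space T b) b.

End Exponential.

Section Algebras.
Context {K : fieldType}.

Definition finitely_generated (B : comAlgType K) : Prop :=
  exists n (x : 'I_n -> B),
    forall b, exists p : mpoly.mpoly n K, mpoly.mmap (GRing.in_alg B) x p = b.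

(* B is nontrivial since comAlgType only contains rings with 1 != 0. *)
Definition affine_domain (B : comAlgType K) : Prop :=
  finitely_generated B /\ GRing.integral_domain_axiom B.

Definition derivation (B : comAlgType K) (D : {linear B -> B}) : Prop :=
  forall a b, D (a * b) = D a * b + a * D b.

Definition jordan_decomposition (B : comAlgType K)
    (D Ds Dn : {linear B -> B}) : Prop :=
  [/\ derivation Ds /\ semisimple Ds,
      derivation Dn /\ locally_nilpotent Dn,
      forall b, D b = Ds b + Dn b &
      forall b, Ds (Dn b) = Dn (Ds b)].

Record algAut (B : comAlgType K) := AlgAut {
  aut_fun :> {lrmorphism B -> B};
  aut_inv : B -> B;
  aut_funK : cancel aut_fun aut_inv;
  aut_invK : cancel aut_inv aut_fun }.

Definition isotropy (B : comAlgType K) (f : B -> B) : set (algAut B) :=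
  [set phi : algAut B | phi \o f \o aut_inv phi = f].

End Algebras.

(* Main.v *)
Require Import Defs.
From HB Require Import structures.
From mathcomp Require Import all_boot all_order all_algebra.
From mathcomp Require Import all_classical all_reals all_analysis.
From mathcomp Require Import complex ring.

(* A linear functional l on B satisfies l (exp(T) b) = sum_k l (T^k b) / k!, so
   exp(D) is determined by any separating family of functionals, and whatever
   commutes with D commutes with exp(D).
   Conversely, take as functionals the coordinates l_i in an eigenbasis of Ds, with
   eigenvalues a_i. If Dn^m b = 0 then
     l_i (exp(D) b) = e^(a_i) * sum_(j < m) l_i (Dn^j b) / j!.
   Hence, as exp is injective on the spectrum of Ds, the x-eigenspace of Ds is the
   generalized e^x-eigenspace of exp(D), so phi preserves it as soon as phi commutes
   with exp(D). On this eigenspace e^(-x) exp(D) is the exponential of the locally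
   nilpotent Dn, and induction on the nilpotency order shows that phi commutes
   with Dn. *)

Set Implicit Arguments.
Unset Strict Implicit.
Unset Printing Implicit Defensive.

Import Order.TTheory GRing.Theory Num.Theory numFieldNormedType.Exports.

Local Open Scope classical_set_scope.
Local Open Scope ring_scope.
Local Open Scope complex_scope.

(** * Limits of sequences of scalars *)

Section SequentialLimit.
Context {K : numFieldType}.
Implicit Types (u v : nat -> K) (a b l : K).

(* Stated for an abstract K: on R[i]^o itself, unification does not find the
   topological structures in reasonable time. *)
Definition seqlim u l : Prop := (u : nat -> K^o) @ \oo --> (l : K^o).

Lemma seqlim_unique u a b : seqlim u a -> seqlim u b -> a = b.
Proof. exact: (cvg_unique (@norm_hausdorff _ K^o)). Qed.

Lemma seqlim_cst a : seqlim (fun=> a) a.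
Proof. exact: cvg_cst. Qed.

Lemma seqlimD u v a b :
  seqlim u a -> seqlim v b -> seqlim (fun n => u n + v n) (a + b).
Proof. exact: cvgD. Qed.

Lemma seqlimM u v a b :
  seqlim u a -> seqlim v b -> seqlim (fun n => u n * v n) (a * b).
Proof. exact: cvgM. Qed.

Lemma seqlim_sum m (f : 'I_m -> nat -> K) (a : 'I_m -> K) :
  (forall i, seqlim (f i) (a i)) ->
  seqlim (fun n => \sum_i f i n) (\sum_i a i).
Proof.
move=> fa; elim: m f a fa => [|m IH] f a fa.
  rewrite big_ord0 (_ : (fun n => _) = fun=> 0); first exact: seqlim_cst.
  by apply/funext => n; rewrite big_ord0.
rewrite big_ord_recl (_ : (fun n => _) =
    fun n => f ord0 n + \sum_(i < m) f (lift ord0 i) n).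
  exact/seqlimD/IH.
by apply/funext => n; rewrite big_ord_recl.
Qed.

Lemma seqlimP u l :
  seqlim u l <->
  forall e, 0 < e -> exists N, forall n, (N <= n)%N -> `|l - u n| < e.
Proof.
split=> [/cvgrPdist_lt ul e /ul[N _ uN]|ul]; first by exists N => n /uN.
by apply/cvgrPdist_lt => e /ul[N uN]; exists N => // n /= /uN.
Qed.

Lemma seqlim_shift u l j : seqlim u l -> seqlim (fun n => u (n - j)%N) l.
Proof.
move=> /seqlimP ul; apply/seqlimP => e /ul[N uN].
exists (N + j)%N => n nN; apply: uN.
by rewrite leq_subRL ?(leq_trans _ nN) ?leq_addl// addnC.
Qed.

Lemma seqlim0_le u v : (forall n, `|u n| <= v n) -> seqlim v 0 -> seqlim u 0.
Proof.
move=> uv /seqlimP v0; apply/seqlimP => e /v0[N vN].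
exists N => n /vN; rewrite !sub0r !normrN; apply: le_lt_trans.
apply: (le_trans (uv n)); apply: real_ler_norm; apply: ger0_real.
exact: le_trans (uv n).
Qed.

End SequentialLimit.
Arguments seqlim_cst {K} a.

(** * Dominated complex series and the complex exponential *)

Section ComplexSeries.
Context {R : realType}.
Local Notation C := R[i].

Lemma seqlim_real_complex (u : nat -> R) (x : R) :
  seqlim u x -> seqlim (fun n => (u n)%:C) x%:C.
Proof.
move=> /seqlimP ux; apply/seqlimP => e e0.
(* Positive elements of [R[i]] are real, so the tolerance [e] comes from [R]. *)
have eE : e = (complex.Re e)%:C by rewrite RRe_real // gtr0_real.
have [|N uN] := ux (complex.Re e); first by move: e0; rewrite {1}eE ltcR.
exists N => n /uN; rewrite -rmorphB/= eE normc_def /= expr0n addr0.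
by rewrite sqrtr_sqr ltcR.
Qed.

Lemma seqlim_complex (u : nat -> C) (x y : R) :
  seqlim (fun n => complex.Re (u n)) x -> seqlim (fun n => complex.Im (u n)) y ->
  seqlim u (x +i* y).
Proof.
move=> /seqlim_real_complex ux /seqlim_real_complex uy.
have := seqlimD ux (seqlimM (seqlim_cst 'i%C) uy).
rewrite -(complexE (x +i* y)).
by congr (seqlim _ _); apply/funext => n; rewrite [RHS]complexE.
Qed.

(** Real and imaginary parts are real series dominated by [v], hence absolutely convergent. *)
Lemma seqlim_series_le (u : nat -> C) (v : nat -> R) :
  (forall k, `|u k| <= (v k)%:C) -> cvgn (series v) ->
  exists l, seqlim (fun n => \sum_(k < n) u k) l.
Proof.
move=> uv cv.
have v0 k : 0 <= v k by rewrite -ler0c (le_trans _ (uv k)).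
have cvg_part (f : C -> R) : {morph f : x y / x + y} -> f 0 = 0 ->
    (forall z, `|f z|%:C <= `|z|) ->
    exists x, seqlim (fun n => f (\sum_(k < n) u k)) x.
  move=> fD f0 fle.
  have /cvg_ex[x ux] : cvgn (series (fun k => f (u k))).
    apply: normed_cvg; apply: series_le_cvg cv => // k.
      by rewrite /= normr_ge0.
    by rewrite -lecR; exact: le_trans (fle _) (uv k).
  exists x; move: ux; congr (seqlim _ _); apply/funext => n.
  by rewrite seriesEord (big_morph f fD f0).
have [||x ux] := cvg_part _ _ _ (@normc_ge_Re R) => //.
  by move=> [? ?] [? ?].
have [|||y uy] := cvg_part (@complex.Im R) => //.
- by move=> [? ?] [? ?].
(* Up to sign, Im z is Re (i z), so the bound for real parts applies. *)
- move=> z; have -> : `|z| = `|z * 'i%C|.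
    rewrite normrM (_ : `|'i%C| = 1) ?mulr1 // normc_def /= expr0n expr1n.
    by rewrite add0r sqrtr1.
  by apply: le_trans (normc_ge_Re _); rewrite ReiNIm normrN.
by exists (x +i* y); exact: seqlim_complex.
Qed.

Lemma normc_real (z : C) : exists2 x : R, 0 <= x & `|z| = x%:C.
Proof. by rewrite normc_def; eexists; last reflexivity; rewrite sqrtr_ge0. Qed.

Lemma exp_coeff_complex (x : R) k :
  (exp_coeff x k)%:C = x%:C ^+ k / k`!%:R.
Proof. by rewrite /exp_coeff /= rmorphM rmorphXn fmorphV rmorph_nat. Qed.

Lemma seqlim_expC (z : C) :
  seqlim (fun n => \sum_(k < n) z ^+ k / k`!%:R) (expC z).
Proof.
have [x x0 zx] := normc_real z.
have [k||l ul] := @seqlim_series_le (fun k => z ^+ k / k`!%:R) (exp_coeff x).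
- by rewrite exp_coeff_complex normrM normfV normr_nat normrX zx.
- exact: is_cvg_series_exp_coeff.
have cu : seqlim (series (fun k => z ^+ k / k`!%:R : C^o)) l.
  by move: ul; congr (seqlim _ _); apply/funext => n; rewrite seriesEord.
by rewrite (_ : expC z = l) //; exact: (cvg_lim (@norm_hausdorff _ C^o) cu).
Qed.

Arguments seqlim_expC z : clear implicits.

(** The reindexing behind the Cauchy products in [expCD] and [functional_exp]. *)
Lemma sum_antidiagonal (V : nmodType) (F : nat -> nat -> V) n :
  \sum_(k < n) \sum_(i < k.+1) F i (k - i)%N =
  \sum_(i < n) \sum_(j < n - i) F i j.
Proof.
elim: n => [|n IH]; first by rewrite !big_ord0.
rewrite big_ord_recr /= IH !big_ord_recr /= subSnn big_ord1 subnn addrA.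
congr (_ + _); rewrite -big_split /=; apply: eq_bigr => i _.
by rewrite subSn ?big_ord_recr//= ltnW.
Qed.

(* The defect of multiplicativity of the partial sums is a sum over
   {(i, j) | i, j < n <= i + j}; in absolute value it is at most the defect for
   |z| and |w|, which tends to 0 because the real exponential is additive. *)
Lemma expCD (z w : C) : expC (z + w) = expC z * expC w.
Proof.
pose S (K : numFieldType) (x : K) n := \sum_(k < n) x ^+ k / k`!%:R.
pose T (K : numFieldType) (x y : K) n :=
  \sum_(i < n) \sum_(j < n | ~~ (j < n - i)%N)
    (x ^+ i / i`!%:R) * (y ^+ j / j`!%:R).
have defect (K : numFieldType) (x y : K) n :
    S K (x + y) n = S K x n * S K y n - T K x y n.
  pose F i j := (x ^+ i / i`!%:R) * (y ^+ j / j`!%:R).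
  have -> : S K (x + y) n = \sum_(k < n) \sum_(i < k.+1) F i (k - i)%N.
    apply: eq_bigr => k _; rewrite addrC exprDn mulr_suml; apply: eq_bigr => i _.
    have ik : (i <= k)%N by rewrite -ltnS.
    rewrite /F -mulr_natr -(bin_fact ik) !natrM; field.
    by rewrite !pnatr_eq0 -!lt0n bin_gt0 ik !fact_gt0.
  rewrite sum_antidiagonal /S /T big_distrlr /=; apply/eqP.
  rewrite eq_sym subr_eq -big_split /=; apply/eqP/eq_bigr => i _.
  rewrite (bigID (fun j : 'I_n => (j < n - i)%N)) /=; congr (_ + _).
  by rewrite (big_ord_widen n (F i)) ?leq_subr.
have [x x0 zx] := normc_real z; have [y y0 wy] := normc_real w.
have T0 : seqlim (T C z w) 0.
  apply: (@seqlim0_le _ _ (fun n => (T R x y n)%:C)).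
    move=> n; apply: le_trans (ler_norm_sum _ _ _) _; rewrite rmorph_sum /=.
    apply: ler_sum => i _; apply: le_trans (ler_norm_sum _ _ _) _.
    rewrite rmorph_sum /=; apply: ler_sum => j _.
    rewrite !normrM !normfV !normr_nat !normrX zx wy.
    by rewrite !rmorphM !rmorphXn !fmorphV !rmorph_nat.
  apply: seqlim_real_complex.
  have lim_expR t : seqlim (S R t) (expR t).
    have : seqlim (series (exp_coeff t)) (expR t) := is_cvg_series_exp_coeff t.
    by congr (seqlim _ _); apply/funext => n; rewrite seriesEord.
  have := seqlimD (seqlimM (lim_expR x) (lim_expR y))
                  (seqlimM (seqlim_cst (-1)) (lim_expR (x + y))).
  rewrite expRD mulN1r subrr; congr (seqlim _ _); apply/funext => n.
  by rewrite defect mulN1r opprB addrC subrK.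
suff lim_prod : seqlim (S C (z + w)) (expC z * expC w).
  exact: seqlim_unique (seqlim_expC (z + w)) lim_prod.
have := seqlimD (seqlimM (seqlim_expC z) (seqlim_expC w))
                (seqlimM (seqlim_cst (-1)) T0).
rewrite mulr0 addr0; congr (seqlim _ _); apply/funext => n.
by rewrite [RHS]defect mulN1r.
Qed.

(** The inverse of [expC z] is [expC (- z)], because [expC 0 = 1]. *)
Lemma expC_neq0 (z : C) : expC z != 0.
Proof.
have lim1 : seqlim (fun n => \sum_(k < n) (0 : C) ^+ k / k`!%:R) 1.
  apply/seqlimP => e e0; exists 1%N => -[//|n] _.
  rewrite big_ord_recl big1 ?expr0 ?divr1 ?addr0 ?subrr ?normr0// => i _.
  by rewrite expr0n mul0r.
have e0 : expC 0 = 1 :> C := seqlim_unique (seqlim_expC 0) lim1.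
apply/eqP => z0; have := expCD z (- z); rewrite subrr e0 z0 mul0r.
by move/eqP; rewrite oner_eq0.
Qed.

End ComplexSeries.
Arguments seqlim_expC {R} z.

(** * Entries of the matrix exponential *)

Section MatrixExponential.
Context {R : realType} (n : nat) (A : 'M[R[i]]_n).
Local Notation C := R[i].

(** Take for [x] the sum of the absolute values of all entries: it bounds every row sum, so each
    further factor [A] costs at most [x]. *)
Lemma entry_expmx_bound :
  exists x : R, forall k i j, `|(A ^+ k) i j| <= (x ^+ k)%:C.
Proof.
have [x x0 xE] := normc_real (\sum_i \sum_j `|A i j|).
have Ax i : \sum_j `|A i j| <= x%:C.
  rewrite -xE ger0_norm; last by apply: sumr_ge0 => ? _; apply: sumr_ge0.
  by rewrite [leRHS](bigD1 i)//= ler_wpDr//; apply: sumr_ge0 => ? _; apply: sumr_ge0.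
exists x; elim=> [|k IH] i j.
  by rewrite expr0 mxE; case: eqP; rewrite ?normr1 ?normr0 ?ler01.
rewrite exprS mxE (le_trans (ler_norm_sum _ _ _))//.
rewrite exprS rmorphM /=; apply: le_trans (ler_wpM2r _ (Ax i)).
  by rewrite mulr_suml; apply: ler_sum => l _; rewrite normrM ler_wpM2l.
by rewrite ler0c exprn_ge0.
Qed.

(** The entries converge by domination, hence so do the matrices in the product topology; [limn] is
    thus a true limit and can be projected to an entry. *)
Lemma seqlim_expmx i j :
  seqlim (fun N => \sum_(k < N) k`!%:R^-1 * (A ^+ k) i j) (expmx A i j).
Proof.
pose S : nat -> 'M[C^o]_n := series (fun k => k`!%:R^-1 *: A ^+ k : 'M[C^o]_n).
have SE N a b : S N a b = \sum_(k < N) k`!%:R^-1 * (A ^+ k) a b.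
  by rewrite /S seriesEord /= summxE; apply: eq_bigr => k _; rewrite mxE.
have [x Ax] := entry_expmx_bound.
have lim_entry a b : exists l, seqlim (fun N => S N a b) l.
  have [k||l ul] := @seqlim_series_le _
      (fun k => k`!%:R^-1 * (A ^+ k) a b) (exp_coeff x).
  - rewrite exp_coeff_complex normrM normfV normr_nat mulrC -rmorphXn.
    by rewrite ler_wpM2r ?invr_ge0.
  - exact: is_cvg_series_exp_coeff.
  by exists l; move: ul; congr (seqlim _ _); apply/funext => N; rewrite SE.
have [l Sl] : exists l : 'M[C^o]_n, forall a b, seqlim (fun N => S N a b) (l a b).
  have /choice[f fP] : forall ab, exists l, seqlim (fun N => S N ab.1 ab.2) l.
    by case=> a b; exact: lim_entry.
  by exists (\matrix_(a, b) f (a, b)) => a b; rewrite mxE; exact: fP (a, b).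
have cvgS : S @ \oo --> l.
  move=> U [P lP PU].
  have /choice[N NP] (ab : 'I_n * 'I_n) : exists N, forall k, (N <= k)%N ->
      P ab.1 ab.2 (S k ab.1 ab.2).
    by have [N _ NP] := Sl ab.1 ab.2 _ (lP ab.1 ab.2); exists N => k /NP.
  exists (\max_ab N ab) => // k /= Nk; apply: PU => a b.
  by apply: (NP (a, b)); apply: leq_trans Nk; exact: leq_bigmax.
have cvg_expmx : S @ \oo --> (expmx A : 'M[C^o]_n) := cvgP _ cvgS.
rewrite (_ : (fun N => _) = (fun N => S N i j)).
  (* Projection is continuous: the preimage of [U] is the box with side [U] at [(i, j)] and the
     whole space elsewhere. *)
  move=> U AU; apply: (cvg_expmx [set M : 'M[C^o]_n | U (M i j)]).
  exists (fun a b => if (a == i) && (b == j) then U else setT).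
    move=> a b; case: ifP => [/andP[/eqP-> /eqP->]|_]; first exact: AU.
    exact: filterT.
  by move=> M /(_ i j); rewrite !eqxx.
by apply/funext => N; rewrite SE.
Qed.

End MatrixExponential.

(** * Linear spans and cyclic spaces *)

Section LinearSpan.
Context {K : fieldType} {V : lmodType K}.

Lemma linspan_ind (W : set V) (P : V -> Prop) :
  P 0 -> (forall a x y, W x -> P y -> P (a *: x + y)) ->
  forall v, linspan W v -> P v.
Proof.
move=> P0 PS v [n [s [c [Ws ->]]]]; elim: n s c Ws => [|n IH] s c Ws.
  by rewrite big_ord0.
by rewrite big_ord_recl; apply: PS => //; apply: IH => i.
Qed.

Lemma linspan_range n (e : 'I_n -> V) v :
  linspan (range e) v -> exists c : 'I_n -> K, v = \sum_i c i *: e i.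
Proof.
move: v; apply: linspan_ind => [|a _ _ [i _ <-] [c ->]].
  by exists (fun=> 0); rewrite big1 // => i _; rewrite scale0r.
exists (fun j => a * (j == i)%:R + c j).
rewrite (eq_bigr _ (fun j _ => scalerDl _ _ _)) big_split; congr (_ + _).
rewrite (bigD1 i) //= eqxx mulr1 big1 ?addr0// => j /negPf ->.
by rewrite mulr0 scale0r.
Qed.

Lemma linspan_in (W : set V) v : W v -> linspan W v.
Proof.
move=> Wv; exists 1, (fun=> v), (fun=> 1); split=> //.
by rewrite big_ord1 scale1r.
Qed.

Lemma cyclic_space_self (T : V -> V) b : cyclic_space T b b.
Proof. by apply: linspan_in; exists 0. Qed.

Lemma cyclic_space_stable (T : {linear V -> V}) b v :
  cyclic_space T b v -> cyclic_space T b (T v).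
Proof.
move=> [n [s [c [Ws ->]]]]; exists n, (T \o s), c; split.
  by move=> i; have [k _ /= sk] := Ws i; exists k.+1; rewrite //= sk.
by rewrite linear_sum; apply: eq_bigr => i _; rewrite linearZ.
Qed.

End LinearSpan.

(** * Coordinates in a basis of arbitrary cardinality *)

Section Coordinates.
Context {K : fieldType} {V : lmodType K} {I : Type} (e : I -> V).

(** The list [s] contains the finite support of [c]; [{classic I}] supplies the decidable equality
    that [I] lacks. *)
Definition coordinates (v : V) (c : I -> K) : Prop :=
  exists s : seq {classic I}, [/\ uniq s,
    forall i : {classic I}, i \notin s -> c i = 0 & v = \sum_(i <- s) c i *: e i].

(** Lets two vectors be expanded over a common list, so that expansions can be added. *)
Lemma coordinates_widen v c (s t : seq {classic I}) :
  uniq s -> uniq t -> {subset s <= t} ->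
  (forall i : {classic I}, i \notin s -> c i = 0) ->
  v = \sum_(i <- s) c i *: e i -> v = \sum_(i <- t) c i *: e i.
Proof.
move=> us ut st cs ->; rewrite [RHS](bigID (fun i => i \in s)) /=.
rewrite [X in _ + X]big1 ?addr0; last by move=> i /cs ->; rewrite scale0r.
rewrite -[RHS]big_filter; apply: perm_big; apply: uniq_perm; rewrite ?filter_uniq//.
by move=> i; rewrite mem_filter; case: (boolP (i \in s)) => // /st ->.
Qed.

Lemma coordinates_lin a u v c d :
  coordinates u c -> coordinates v d ->
  coordinates (a *: u + v) (fun i => a * c i + d i).
Proof.
move=> [s [us cs uE]] [t [ut dt vE]]; exists (undup (s ++ t)); split.
- exact: undup_uniq.
- move=> i; rewrite mem_undup mem_cat negb_or => /andP[/cs -> /dt ->].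
  by rewrite mulr0 addr0.
have [ust st ts] : [/\ uniq (undup (s ++ t)), {subset s <= undup (s ++ t)}
    & {subset t <= undup (s ++ t)}].
  split; first exact: undup_uniq.
    by move=> i si; rewrite mem_undup mem_cat si.
  by move=> i ti; rewrite mem_undup mem_cat ti orbT.
rewrite (coordinates_widen us ust st cs uE) (coordinates_widen ut ust ts dt vE).
rewrite scaler_sumr -big_split /=; apply: eq_bigr => i _.
by rewrite scalerDl scalerA.
Qed.

Hypothesis free_e : free_family e.

Lemma coordinates0 c : coordinates 0 c -> forall i, c i = 0.
Proof.
move=> [s [us cs sE]] i; have [si|/cs//] := boolP ((i : {classic I}) \in s).
(* A list without repetition is an injective map from an ordinal, the form in which freeness is
   stated. *)
have /tuple_uniqP inj_s : uniq (in_tuple s) by [].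
have := free_e (f := tnth (in_tuple s)) inj_s (c := c \o tnth (in_tuple s)).
rewrite -(big_tuple _ _ (in_tuple s) xpredT (fun i => c i *: e i)) /=.
move=> /(_ (esym sE)); have /tnthP[k ->] : (i : {classic I}) \in in_tuple s by [].
exact.
Qed.

Lemma coordinates_uniq v c d :
  coordinates v c -> coordinates v d -> forall i, c i = d i.
Proof.
move=> vc vd i; have := coordinates_lin (-1) vc vd.
rewrite scaleN1r addNr => /coordinates0 /(_ i).
by rewrite mulN1r addrC => /eqP; rewrite subr_eq0 => /eqP.
Qed.

Hypothesis span_e : linspan (range e) = setT.

Lemma coordinates_ex v : exists c, coordinates v c.
Proof.
have : linspan (range e) v by rewrite span_e.
move: v; apply: linspan_ind => [|a _ y [i _ <-] [c yc]].
  by exists (fun=> 0), [::]; rewrite big_nil.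
exists (fun j : {classic I} => a * (j == i)%:R + c j); apply: coordinates_lin yc.
exists [:: i : {classic I}]; split => //.
  by move=> j; rewrite inE => /negPf ->.
by rewrite big_seq1 eqxx scale1r.
Qed.

End Coordinates.

(** [l i] is the i-th coordinate in an eigenbasis, linear by uniqueness of coordinates. These
    functionals reduce identities in [V], which has no topology, to limits of scalars. *)
Lemma semisimple_functionals (K : fieldType) (V : lmodType K) (T : {linear V -> V}) :
  semisimple T ->
  exists (I : Type) (l : I -> {scalar V}) (a : I -> K),
    [/\ forall v, (forall i, l i v = 0) -> v = 0,
        forall i v, l i (T v) = a i * l i v,
        forall i, exists2 v, v != 0 & T v = a i *: v &
        linspan [set v | exists c, T v = c *: v] = setT].
Proof.
move=> [I [e [[free_e span_e] /choice[a aE]]]].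
have /choice[c cP] := coordinates_ex span_e.
have c_lin i : scalar (c^~ i).
  move=> k u v; have uv_c := coordinates_lin k (cP u) (cP v).
  exact: (coordinates_uniq free_e (cP _) uv_c i).
pose l i : {scalar V} := HB.pack (c^~ i) (GRing.isLinear.Build _ _ _ _ _ (c_lin i)).
exists I, l, a; split.
- by move=> v c0; have [s [_ _ ->]] := cP v; rewrite big1 // => i _;
    rewrite [c v i]c0 scale0r.
- move=> i v; suff Tv : coordinates e (T v) (fun i => a i * c v i).
    exact: (coordinates_uniq free_e (cP _) Tv i).
  have [s [us cs vE]] := cP v; exists s; split => //.
    by move=> j /cs ->; rewrite mulr0.
  rewrite [in LHS]vE linear_sum; apply: eq_bigr => j _.
  by rewrite linearZ /= aE scalerA mulrC.
- move=> i; exists (e i); last exact: aE.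
  apply/eqP => ei0; have inj_i : injective (fun _ : 'I_1 => i).
    by move=> j k _; rewrite !ord1.
  have := free_e 1 _ inj_i (fun=> 1); rewrite big_ord1 scale1r => /(_ ei0 ord0).
  by move/eqP; rewrite oner_eq0.
apply/seteqP; split=> // v _.
have [n [s [d [es ->]]]] : linspan (range e) v by rewrite span_e.
by exists n, s, d; split=> // i; have [j _ <-] := es i; exists (a j).
Qed.

Lemma iter_matrix (K : fieldType) (V : lmodType K) (T : {linear V -> V}) n
    (e : 'I_n -> V) (A : 'M[K]_n) (c : 'rV_n) k :
  (forall i, T (e i) = \sum_j A i j *: e j) ->
  iter k T (\sum_i c 0 i *: e i) = \sum_j (c *m A ^+ k) 0 j *: e j.
Proof.
move=> TA; elim: k => [|k IH] /=; first by rewrite expr0 mulmx1.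
rewrite IH linear_sum exprSr mulmxA; under [RHS]eq_bigr do rewrite mxE scaler_suml.
rewrite exchange_big; apply: eq_bigr => i _; rewrite linearZ /= TA scaler_sumr.
by apply: eq_bigr => j _; rewrite scalerA.
Qed.

Lemma iter_comm (V : Type) (f g : V -> V) m x :
  (forall y, f (g y) = g (f y)) -> iter m f (g x) = g (iter m f x).
Proof. by move=> fg; elim: m => //= m ->. Qed.

(* Weak form of exp(T) b = sum_k T^k b / k!, which no longer involves bases. *)
Lemma seqlim_exp_lf (R : realType) (V : lmodType R[i]) (T : {linear V -> V})
    (l : {scalar V}) (b : V) :
  finite_dimensional (cyclic_space T b) ->
  seqlim (fun N => \sum_(k < N) l (iter k T b) / k`!%:R) (l (exp_lf T b)).
Proof.
move=> [n [e eV]].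
have eW i : cyclic_space T b (e i).
  by rewrite -eV.2; apply: linspan_in; exists i.
have /choice[a aE] i : exists a : 'I_n -> R[i], T (e i) = \sum_j a j *: e j.
  by apply: linspan_range; rewrite eV.2; exact: cyclic_space_stable.
have [c cE] : exists c : 'I_n -> R[i], b = \sum_j c j *: e j.
  by apply: linspan_range; rewrite eV.2; exact: cyclic_space_self.
pose A : 'M[R[i]]_n := \matrix_(i0, j) a i0 j.
pose r : 'rV[R[i]]_n := \row_j c j.
have : exists w, exists n, exists (e : 'I_n -> V) (A : 'M[R[i]]_n) (c : 'rV[R[i]]_n),
    [/\ is_basis e (cyclic_space T b), forall i, T (e i) = \sum_j A i j *: e j,
        b = \sum_i c 0 i *: e i & w = \sum_j (c *m expmx A) 0 j *: e j].
  exists (\sum_j (r *m expmx A) 0 j *: e j), n, e, A, r; split=> //.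
    by move=> i; rewrite aE; apply: eq_bigr => j _; rewrite mxE.
  by rewrite {1}cE; apply: eq_bigr => j _; rewrite mxE.
(* The basis above only shows that the set in [exp_on] is inhabited; the value picked by [xget]
   comes with a basis of its own. *)
move=> /(xgetPex 0); rewrite -/(exp_on T (cyclic_space T b) b) -/(exp_lf T b).
move: (exp_lf T b) => w {n e eV eW a aE c cE A r} [n [e [A [c [_ TA -> ->]]]]].
have lim_w : seqlim
    (fun N => \sum_j \sum_i
      c 0 i * (\sum_(k < N) k`!%:R^-1 * (A ^+ k) i j) * l (e j))
    (\sum_j \sum_i c 0 i * expmx A i j * l (e j)).
  apply: seqlim_sum => j; apply: seqlim_sum => i.
  apply: seqlimM (seqlim_cst _); apply: seqlimM (seqlim_cst _) _.
  exact: seqlim_expmx.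
rewrite linear_sum (eq_bigr (fun j => \sum_i c 0 i * expmx A i j * l (e j))).
  move: lim_w; congr (seqlim _ _); apply/funext => N.
  transitivity (\sum_(k < N) \sum_j \sum_i
      c 0 i * (k`!%:R^-1 * (A ^+ k) i j) * l (e j)).
    rewrite [RHS]exchange_big; apply: eq_bigr => j _.
    rewrite [RHS]exchange_big; apply: eq_bigr => i _ /=.
    by rewrite mulr_sumr mulr_suml.
  apply: eq_bigr => k _; rewrite (iter_matrix _ _ TA) linear_sum mulr_suml.
  apply: eq_bigr => j _; rewrite linearZ /= mxE !mulr_suml; apply: eq_bigr => i _.
  by ring.
by move=> j _; rewrite linearZ /= mxE mulr_suml.
Qed.
Arguments seqlim_exp_lf {R V T} l {b} _.

Lemma iter_linear0 (K : pzRingType) (V : lmodType K) (T : {linear V -> V}) k :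
  iter k T 0 = 0.
Proof. by elim: k => //= k ->; rewrite linear0. Qed.

(** * The exponential in terms of the Jordan decomposition *)

Section ExponentialOfJordan.
Context {R : realType} {V : lmodType R[i]} (D Ds Dn : {linear V -> V}).
Hypothesis lfD : locally_finite D.
Hypothesis DE : forall b, D b = Ds b + Dn b.
Hypothesis DsDn : forall b, Ds (Dn b) = Dn (Ds b).
Hypothesis nilDn : locally_nilpotent Dn.
Context {I : Type} (l : I -> {scalar V}) (a : I -> R[i]).
Hypothesis sep : forall v, (forall i, l i v = 0) -> v = 0.
Hypothesis lDs : forall i v, l i (Ds v) = a i * l i v.
Local Notation G := (exp_lf D).

Lemma functional_ext u v : (forall i, l i u = l i v) -> u = v.
Proof.
move=> uv; apply/eqP; rewrite -subr_eq0; apply/eqP/sep => i.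
by rewrite linearB uv subrr.
Qed.

Lemma DDn b : D (Dn b) = Dn (D b).
Proof. by rewrite !DE linearD DsDn. Qed.

Lemma DDs b : D (Ds b) = Ds (D b).
Proof. by rewrite !DE linearD DsDn. Qed.

(** Binomial formula for the k-th power of [Ds + Dn], where [f] turns [Ds] into the scalar [x]; the
    induction step is Pascal's rule. *)
Lemma functional_iter (f : {scalar V}) (x : R[i]) k b :
  (forall v, f (Ds v) = x * f v) ->
  f (iter k D b) = \sum_(j < k.+1) (x ^+ (k - j) * f (iter j Dn b)) *+ 'C(k, j).
Proof.
move=> fDs; elim: k b => [|k IH] b.
  by rewrite big_ord_recl big_ord0 addr0 mul1r.
rewrite iterS DE linearD fDs IH -(iter_comm _ _ (fun y => DDn y)) IH.
rewrite big_ord_recl mulrDr big_ord_recr.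
rewrite [in RHS]big_ord_recl [in RHS]big_ord_recr /=.
rewrite !binn !subnn !subn0 !bin0 !mulr1n mulrA -exprS -iterSr -!addrA.
congr (_ + _); rewrite !addrA; congr (_ + _).
rewrite mulr_sumr -big_split; apply: eq_bigr => i _ /=.
rewrite -iterSr subSS mulrnAr mulrA -exprS -subSn ?(valP i)// subSS -mulrnDr.
by rewrite binS.
Qed.

(** The series is the Cauchy product of those of e^x and of [Dn]. The latter has at most [m] nonzero
    terms, so only shifted partial sums of e^x have to converge. *)
Lemma functional_exp (f : {scalar V}) (x : R[i]) m b :
  (forall v, f (Ds v) = x * f v) -> iter m Dn b = 0 ->
  f (G b) = expC x * \sum_(j < m) f (iter j Dn b) / j`!%:R.
Proof.
move=> fDs nb; pose t j := f (iter j Dn b) / j`!%:R.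
pose S n := \sum_(k < n) x ^+ k / k`!%:R.
have t0 j : t (m + j)%N = 0.
  by rewrite /t addnC iterD nb iter_linear0 linear0 mul0r.
have lim_t : seqlim (fun N => \sum_(j < m) t j * S (N - j)%N)
                    (\sum_(j < m) t j * expC x).
  apply: seqlim_sum => j; apply: seqlimM (seqlim_cst _) _.
  exact: seqlim_shift (seqlim_expC x).
suff lim_G : seqlim (fun N => \sum_(k < N) f (iter k D b) / k`!%:R)
    (\sum_(j < m) t j * expC x).
  rewrite (seqlim_unique (seqlim_exp_lf f (lfD b)) lim_G).
  by rewrite -mulr_suml mulrC.
move: lim_t; congr (seqlim _ _); apply/funext => N.
transitivity (\sum_(k < N) \sum_(j < k.+1) t j * (x ^+ (k - j) / (k - j)`!%:R)).
  rewrite (sum_antidiagonal (fun i j => t i * (x ^+ j / j`!%:R))).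
  under [RHS]eq_bigr do rewrite -mulr_sumr.
  (* Both sums extend to [m + N] terms: [t j] vanishes for [j >= m], and for [j >= N] the truncated
     [N - j] is 0, which makes [S] an empty sum. *)
  transitivity (\sum_(j < m + N) t j * S (N - j)%N).
    rewrite big_split_ord /= [X in _ + X]big1 ?addr0// => i _.
    by rewrite t0 mul0r.
  rewrite addnC big_split_ord /= [X in _ + X]big1 ?addr0// => i _.
  have -> : (N - (N + i) = 0)%N by apply/eqP; rewrite subn_eq0 leq_addr.
  by rewrite /S big_ord0 mulr0.
apply: eq_bigr => k _; rewrite (functional_iter _ _ fDs) mulr_suml.
apply: eq_bigr => j _; rewrite /t.
have jk : (j <= k)%N by rewrite -ltnS.
rewrite -[in RHS]mulr_natr -(bin_fact jk) !natrM; field.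
by rewrite !pnatr_eq0 -!lt0n bin_gt0 jk !fact_gt0.
Qed.

(** [l i \o T] is again a functional, so the i-th coordinates of both sides are limits of the same
    sequence. *)
Lemma exp_lf_comm (T : {linear V -> V}) :
  (forall b, T (D b) = D (T b)) -> forall b, T (G b) = G (T b).
Proof.
move=> TD b; apply: functional_ext => i.
pose lT : {scalar V} := l i \o T.
have := seqlim_exp_lf (l i) (lfD (T b)).
have := seqlim_exp_lf lT (lfD b); move=> lim1 lim2.
apply: seqlim_unique lim1 _; move: lim2; congr (seqlim _ _).
apply/funext => N; apply: eq_bigr => k _.
by rewrite (iter_comm _ _ (fun y => esym (TD y))).
Qed.

(** By definition [exp_lf D b] is computed in a space that depends on [b]; the weak series has no
    such dependence. *)
Lemma exp_lf_is_linear : linear G.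
Proof.
move=> k u v; apply: functional_ext => i; rewrite linearP.
have lim_sum := seqlimD (seqlimM (seqlim_cst k) (seqlim_exp_lf (l i) (lfD u)))
                        (seqlim_exp_lf (l i) (lfD v)).
apply: seqlim_unique (seqlim_exp_lf (l i) (lfD (k *: u + v))) _.
move: lim_sum; congr (seqlim _ _); apply/funext => N.
rewrite mulr_sumr -big_split; apply: eq_bigr => j _ /=.
rewrite mulrA -mulrDl; congr (_ / _).
by elim: (nat_of_ord j) u v => [|n IH] u v; rewrite ?linearP// !iterSr linearP IH.
Qed.

(* G with its linear structure; a variable so that simplification keeps it folded. *)
Variable E : {linear V -> V}.
Hypothesis EE : forall v, E v = G v.

Lemma coord_exp m b i : iter m Dn b = 0 ->
  l i (E b) = expC (a i) * \sum_(j < m) l i (iter j Dn b) / j`!%:R.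
Proof. by move=> nb; rewrite EE; exact: functional_exp. Qed.

Lemma exp_Dn b : E (Dn b) = Dn (E b).
Proof. by rewrite !EE exp_lf_comm// => v; rewrite DDn. Qed.

Lemma exp_Ds b : E (Ds b) = Ds (E b).
Proof. by rewrite !EE exp_lf_comm// => v; rewrite DDs. Qed.

(** * Eigenspaces of [Ds] and generalized eigenspaces of exp(D) *)

Section Eigenvalue.
Variable x : R[i].
Implicit Types (u v : V) (i : I).
Let eigen v := Ds v = x *: v.

Lemma coord_eigen v i : eigen v -> (a i - x) * l i v = 0.
Proof. by move=> vx; rewrite mulrBl -lDs vx linearZ /= subrr. Qed.

Lemma eigen_coord v : (forall i, (a i - x) * l i v = 0) -> eigen v.
Proof.
move=> vx; apply: functional_ext => i; rewrite lDs linearZ /=.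
by apply/eqP; rewrite -subr_eq0 -mulrBl vx.
Qed.

(* Semisimplicity: ker (Ds - x)^2 = ker (Ds - x). *)
Lemma eigen_reduced v : eigen (Ds v - x *: v) -> eigen v.
Proof.
move=> vx; apply: eigen_coord => i.
have /eqP := coord_eigen i vx; rewrite linearB linearZ /= lDs -mulrBl mulf_eq0.
by case/orP => /eqP // ->; rewrite mul0r.
Qed.

(** The kernels of the powers of [N] exhaust the generalized e^x-eigenspace of exp(D). *)
Variable N : {linear V -> V}.
Hypothesis NE : forall v, N v = E v - expC x *: v.

Let NDn v : N (Dn v) = Dn (N v).
Proof. by rewrite !NE exp_Dn [RHS]linearB [in RHS]linearZ. Qed.

Let NDs v : N (Ds v) = Ds (N v).
Proof. by rewrite !NE exp_Ds [RHS]linearB [in RHS]linearZ. Qed.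

Lemma eigen_Dn v : eigen v -> eigen (Dn v).
Proof. by move=> vx; rewrite /eigen DsDn vx linearZ /=. Qed.

Lemma eigen_iter j v : eigen v -> eigen (iter j Dn v).
Proof. by move=> vx; elim: j => //= j; exact: eigen_Dn. Qed.

Lemma eigen_exp v : eigen v -> eigen (E v).
Proof. by move=> vx; rewrite /eigen -exp_Ds vx linearZ /=. Qed.

Lemma eigenZ k v : eigen v -> eigen (k *: v).
Proof. by move=> vx; rewrite /eigen linearZ /= vx !scalerA mulrC. Qed.

Lemma eigenB u v : eigen u -> eigen v -> eigen (u - v).
Proof. by move=> ux vx; rewrite /eigen linearB ux vx scalerBr. Qed.

Lemma eigen_N v : eigen v -> eigen (N v).
Proof.
by move=> vx; rewrite NE; apply: eigenB; [exact: eigen_exp|exact: eigenZ].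
Qed.

(** Coordinates with [a i = x] are given by [coord_exp]; the others vanish on the eigenspace, which
    [Dn] preserves. *)
Lemma eigen_expE m v : eigen v -> iter m Dn v = 0 ->
  E v = expC x *: \sum_(j < m) j`!%:R^-1 *: iter j Dn v.
Proof.
move=> vx nv; apply: functional_ext => i.
rewrite (coord_exp i nv) linearZ /= linear_sum /=.
have [->|aix] := eqVneq (a i) x.
  by congr (_ * _); apply: eq_bigr => j _; rewrite linearZ mulrC.
have l0 j : l i (iter j Dn v) = 0.
  have /eqP : (a i - x) * l i (iter j Dn v) = 0.
    exact/coord_eigen/eigen_iter.
  by rewrite mulf_eq0 subr_eq0 (negPf aix) => /eqP.
by rewrite !big1 ?mulr0// => j _; rewrite ?linearZ /= l0 ?mulr0 ?mul0r.
Qed.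

(** exp(D) multiplies [iter m Dn v] by e^x, as [Dn] kills it; so [N], which commutes with [Dn],
    lowers the nilpotency order. *)
Lemma iter_Dn_N m v : eigen v -> iter m.+1 Dn v = 0 -> iter m Dn (N v) = 0.
Proof.
move=> vx nv; rewrite (iter_comm _ _ (fun y => esym (NDn y))).
rewrite !NE (eigen_expE (m := 1) (eigen_iter m vx) nv) big_ord1 fact0 invr1 scale1r.
by rewrite subrr.
Qed.

Lemma iter_N_eigen m v : eigen v -> iter m Dn v = 0 -> iter m N v = 0.
Proof.
elim: m v => [//|m IH] v vx nv; rewrite iterSr; apply: IH; first exact: eigen_N.
exact: iter_Dn_N.
Qed.

Hypothesis a_inj : forall i, expC (a i) = expC x -> a i = x.

(** Induction on the nilpotency order: [Dn v] lies in the eigenspace, so [Dn] kills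
    [w = Ds v - x *: v] and exp(D) scales each coordinate of [w] by e^(a_i). From [N w = 0] and
    [a_inj], [w] has only coordinates with [a i = x]. *)
Lemma ker_N_eigen v : N v = 0 -> eigen v.
Proof.
have [m] := nilDn v; elim: m v => [v /= -> _|m IH v].
  by rewrite /eigen linear0 scaler0.
rewrite iterSr => nv Nv.
have Dnvx : eigen (Dn v) by apply: IH nv _; rewrite NDn Nv linear0.
apply: eigen_reduced; set w := Ds v - x *: v; apply: eigen_coord => i.
have nw : iter 1 Dn w = 0.
  by rewrite /= /w linearB linearZ /= -DsDn Dnvx subrr.
have Nw : N w = 0 by rewrite /w linearB NDs linearZ /= Nv linear0 scaler0 subr0.
have : l i (N w) = 0 by rewrite Nw linear0.
rewrite !NE linearB linearZ /= (coord_exp i nw) big_ord1 fact0 divr1 /=.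
move/eqP; rewrite -mulrBl mulf_eq0 => /orP[|/eqP->]; last by rewrite mulr0.
by rewrite subr_eq0 => /eqP/a_inj->; rewrite subrr mul0r.
Qed.

(** If [N v] lies in the eigenspace, then [N] kills [Ds v - x *: v], and [ker_N_eigen] and
    [eigen_reduced] apply. *)
Lemma iter_N_ker_eigen m v : iter m N v = 0 -> eigen v.
Proof.
elim: m v => [v /= ->|m IH v]; first by rewrite /eigen linear0 scaler0.
rewrite iterSr => /IH Nvx; apply: eigen_reduced; apply: ker_N_eigen.
by rewrite linearB NDs Nvx [X in _ - X]linearZ /= subrr.
Qed.

(** Induction on the order, applied to [Dn v], makes [Dn] kill [Dn v]; then exp(D) v = e^x (v + Dn
    v), and [N v = 0] leaves [Dn v = 0]. *)
Lemma ker_N_ker_Dn v : eigen v -> N v = 0 -> Dn v = 0.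
Proof.
move=> vx; have [m] := nilDn v; elim: m v vx => [v _ /= -> _|m IH v vx].
  exact: linear0.
rewrite iterSr => nv Nv.
have n2v : iter 2 Dn v = 0.
  by apply: IH nv _; [exact: eigen_Dn|rewrite NDn Nv linear0].
move: Nv; rewrite !NE (eigen_expE vx n2v) 2!big_ord_recr big_ord0 /=.
rewrite add0r !invr1 !scale1r scalerDr addrC addrA addNr add0r => /eqP.
by rewrite scaler_eq0 (negPf (expC_neq0 x)) => /eqP.
Qed.

Variable phi : {linear V -> V}.
Hypothesis phiE : forall v, phi (E v) = E (phi v).

Let phiN v : phi (N v) = N (phi v).
Proof. by rewrite !NE [LHS]linearB [in LHS]linearZ phiE. Qed.

(** [phi] commutes with [N], so it preserves the generalized eigenspace, which is the eigenspace of
    [Ds]. *)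
Lemma exp_comm_eigen v : eigen v -> eigen (phi v).
Proof.
move=> vx; have [m nv] := nilDn v; apply: (@iter_N_ker_eigen m).
by rewrite (iter_comm _ _ (fun y => esym (phiN y))) iter_N_eigen// linear0.
Qed.

Lemma exp_comm_Dn v : eigen v -> phi (Dn v) = Dn (phi v).
Proof.
move=> vx; have [m1 nv1] := nilDn v; have [m2 nv2] := nilDn (phi v).
(* With a common order, one induction serves [v] and [phi v], and both exponentials expand to the
   same length. *)
have [m [nv npv]] : exists m, iter m Dn v = 0 /\ iter m Dn (phi v) = 0.
  exists (m1 + m2)%N; split; last by rewrite iterD nv2 iter_linear0.
  by rewrite addnC iterD nv1 iter_linear0.
move=> {m1 m2 nv1 nv2}; elim: m v vx nv npv => [v _ /= -> ->|m IH v vx nv npv].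
  by rewrite !linear0.
have px := exp_comm_eigen vx.
(* The induction hypothesis for N v, which has smaller nilpotency order, gives
   N z = 0, hence Dn z = 0. By the induction hypothesis for the Dn^j v, j > 0, only
   the linear term z remains in the expansion of phi (E v) - E (phi v). *)
set z := phi (Dn v) - Dn (phi v); suff : z = 0 by move/eqP; rewrite subr_eq0 => /eqP.
have zx : eigen z.
  by apply: eigenB; [apply: exp_comm_eigen|]; apply: eigen_Dn.
have Nz : N z = 0.
  rewrite linearB -phiN !NDn -phiN; apply/eqP; rewrite subr_eq0; apply/eqP.
  apply: IH; first exact: eigen_N.
    exact: iter_Dn_N.
  by rewrite phiN iter_Dn_N.
have Dz : Dn z = 0 := ker_N_ker_Dn zx Nz.
(* At order 1 both [Dn v] and [Dn (phi v)] vanish; beyond, the expansions have at least two terms to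
   split off. *)
case: m IH nv npv => [_ /= nv npv|m IH nv npv].
  by rewrite /z nv npv linear0 subrr.
have phiDn : phi (Dn v) = z + Dn (phi v) by rewrite subrK.
have Dn_phi j : iter j.+1 Dn (phi (Dn v)) = iter j.+2 Dn (phi v).
  by rewrite phiDn !iterSr linearD Dz add0r.
have phi_Dn j : phi (iter j Dn (Dn v)) = iter j Dn (phi (Dn v)).
  elim: j => //= j IHj; rewrite -IHj; apply: IH.
  - by apply: eigen_iter; apply: eigen_Dn.
  - by rewrite -iterSr -iterD -addSnnS addnC iterD nv iter_linear0.
  - by rewrite IHj -iterD addnC iterD Dn_phi npv iter_linear0.
have rest j : phi (iter j.+2 Dn v) = iter j.+2 Dn (phi v).
  by rewrite iterSr phi_Dn Dn_phi.
have := phiE v; rewrite (eigen_expE vx nv) (eigen_expE px npv) linearZ.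
move=> /(scalerI (expC_neq0 x)); rewrite linear_sum 4!big_ord_recl /= !linearZ /=.
(* Degree 0 cancels here; degrees from 2 on agree by [rest] and cancel next. *)
move=> /addrI.
rewrite (eq_bigr (fun i : 'I_m => i.+2`!%:R^-1 *: iter i.+2 Dn (phi v))); last first.
  by move=> i _; rewrite linearZ; congr (_ *: _); exact: rest.
move=> /addIr; rewrite (_ : (bump 0 0)`! = 1)%N // invr1 !scale1r => E1.
by rewrite /z E1 subrr.
Qed.

End Eigenvalue.
End ExponentialOfJordan.

(** The linear core, for any endomorphism [phi]. Eigenvectors of [Ds] span [V], so it suffices to
    treat one eigenvalue [x] at a time, where [D] acts as [x] plus [Dn]. *)
Theorem exp_lf_centralizer (R : realType) (V : lmodType R[i])
    (D Ds Dn : {linear V -> V}) (phi : {linear V -> V}) :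
  locally_finite D -> semisimple Ds -> locally_nilpotent Dn ->
  (forall b, D b = Ds b + Dn b) -> (forall b, Ds (Dn b) = Dn (Ds b)) ->
  set_inj [set x | exists2 v, v != 0 & Ds v = x *: v] (expC : R[i] -> R[i]) ->
  (forall b, phi (D b) = D (phi b)) <->
  (forall b, phi (exp_lf D b) = exp_lf D (phi b)).
Proof.
move=> lfD ssDs nilDn DE DsDn exp_inj.
have [I [l [a [sep lDs a_eig span_eig]]]] := semisimple_functionals ssDs.
split=> [phiD b|phiG]; first exact: (exp_lf_comm lfD sep).
pose E : {linear V -> V} := HB.pack (exp_lf D)
  (GRing.isLinear.Build _ _ _ _ (exp_lf D) (exp_lf_is_linear lfD sep)).
have phiDv x v : Ds v = x *: v -> phi (D v) = D (phi v).
  (* A nonzero [v] puts [x] in the spectrum of [Ds], where exp is injective. *)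
  have [->|v0] := eqVneq v 0; first by rewrite !linear0.
  move=> vx; pose N_fun v := E v - expC x *: v.
  have N_lin : linear N_fun.
    move=> k u w; rewrite /N_fun linearP scalerBr scalerDr !scalerA (mulrC k).
    by rewrite opprD addrACA.
  pose N : {linear V -> V} :=
    HB.pack N_fun (GRing.isLinear.Build _ _ _ _ N_fun N_lin).
  have a_inj i : expC (a i) = expC x -> a i = x.
    move=> ax; apply: exp_inj => //; rewrite inE /=; first exact: a_eig.
    by exists v.
  have phi_eig := @exp_comm_eigen _ _ D Ds Dn lfD DE DsDn nilDn I l a sep lDs E
    (fun=> erefl) x N (fun=> erefl) a_inj phi phiG v vx.
  have phiDn := @exp_comm_Dn _ _ D Ds Dn lfD DE DsDn nilDn I l a sep lDs E
    (fun=> erefl) x N (fun=> erefl) a_inj phi phiG v vx.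
  by rewrite !DE linearD vx phi_eig linearZ phiDn.
move=> b; have : linspan [set v | exists c, Ds v = c *: v] b by rewrite span_eig.
move: b; apply: linspan_ind => [|k u v [c uc] IH]; first by rewrite !linear0.
by rewrite !linearP (phiDv c u uc) IH.
Qed.

Theorem proposition4p7 (R : realType) (B : comAlgType R[i])
    (D Ds Dn : {linear B -> B}) (Omega : set R[i]) :
  affine_domain B ->
  derivation D ->
  locally_finite D ->
  jordan_decomposition D Ds Dn ->
  (forall (b : B) (a : R[i]),
     eigenvalue_on Ds (cyclic_space D b) a -> Omega a) ->
  set_inj Omega (expC : R[i] -> R[i]) ->
  isotropy D = isotropy (exp_lf D).
Proof.
move=> _ _ lfD [[_ ssDs] [_ nilDn] DE DsDn] eigOmega injOmega.
(* Each eigenvector lies in its own cyclic space, so [Omega] contains the whole spectrum of [Ds]. *)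
have eig_inj :
    set_inj [set x | exists2 v, v != 0 & Ds v = x *: v] (expC : R[i] -> R[i]).
  move=> x y; rewrite !inE => -[u u0 ux] [v v0 vy]; apply: injOmega; rewrite inE.
    by apply: (eigOmega u); exists u; split=> //; exact: cyclic_space_self.
  by apply: (eigOmega v); exists v; split=> //; exact: cyclic_space_self.
have isotropyP (f : B -> B) (phi : algAut B) :
    isotropy f phi <-> forall b, phi (f b) = f (phi b).
  split=> [phif b|phif].
    by rewrite -{2}phif /= aut_funK.
  by apply/funext => b /=; rewrite phif aut_invK.
apply/seteqP; split=> phi /isotropyP phif; apply/isotropyP.
  exact: ((exp_lf_centralizer phi lfD ssDs nilDn DE DsDn eig_inj).1 phif).
exact: ((exp_lf_centralizer phi lfD ssDs nilDn DE DsDn eig_inj).2 phif).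
Qed.
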